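(* Let $G^l$ and $G^g$ be two finite connected oriented graphs, each with two distinguished vertices $a,b$ at graph distance greater than $1$ and joined by at least two edge-disjoint paths. Let $f_l,f_g$ be their crossing probability functions, $p_l,p_g\in(0,1)$ the respective unique fixed points in $(0,1)$, $\zeta_l=f_l'(p_l)>1$, $\zeta_g=f_g'(p_g)>1$, and let $h_g:(0,1)\to\mathbb R$ be the unique diffeomorphism with $h_g\circ f_g=\zeta_g\cdot h_g$ and $h_g'(p_g)=1$. Let $(l_k)$ and $(g_k)$ be two sequences of positive integers growing to infinity, and let $\Phi_k(p)$ be the crossing probability of the hybrid graph $G_k=\Gamma_l^{(l_k)}\circ\Gamma_g^{(g_k)}(G)$, where $G$ is a single edge. Then there exist sequences $p_k\in(0,1)$ and $\zeta_k\in\mathbb R$ such that, for any $\lambda\in\mathbb R$, $$\Phi_k\Big(p_k+\frac{\lambda}{\zeta_k}\Big)\xrightarrow[k\to\infty]{}h_g^{-1}(\lambda).$$ Moreover, these sequences satisfy: (a) $p_k\to p_l$ as $k\to\infty$, the critical threshold associated with $G^l$; (b) if $l_k\ll g_k$ (i.e. $l_k/g_k\to0$), then $$\lim_{k\to\infty}\frac{1}{l_k+g_k}\log\zeta_k=\log\zeta_g .$$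
   Context: An oriented graph is a finite simple graph with an orientation chosen for each edge; distances, paths and connectivity ignore orientation. For a graph $H$ with distinguished vertices $a,b$, its crossing probability function is $p\mapsto$ the probability that $a$ and $b$ are joined by an open path when each edge of $H$ is independently open with probability $p$. For a graph as in the hypothesis (distance between $a,b$ greater than 1, two edge-disjoint paths) this function has exactly one fixed point in $(0,1)$, where its derivative is strictly larger than one. For an oriented graph $H$, $\Gamma_l(H)$ is the oriented graph obtained by replacing every oriented edge $(e_-,e_+)$ of $H$ by a fresh copy of $G^l$, with $a$ identified with $e_-$ and $b$ with $e_+$; $\Gamma_g$ is defined analogously with $G^g$. $\Gamma^{(n)}$ denotes the $n$-fold iterate. Starting from the single oriented edge $(a_0,b_0)$, the distinguished vertices $a_k,b_k$ of $G_k$ are those that were originally $a_0,b_0$. Thus $\Phi_k(p)=\mathbb P_p(a_k\leftrightarrow b_k\text{ in }G_k)$, which equals $f_g^{(g_k)}\circ f_l^{(l_k)}(p)$ (iterates). *)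

(* Defs.v *)
From HB Require Import structures.
From mathcomp Require Import all_boot all_order all_algebra.
From mathcomp Require Import all_classical all_reals all_analysis.
Set Implicit Arguments.
Unset Strict Implicit.
Unset Printing Implicit Defensive.
Import Order.TTheory GRing.Theory Num.Theory.
Import numFieldNormedType.Exports.
Local Open Scope ring_scope.

(* Edges are labels carrying an origin [src] (e_-) and an end [tgt] (e_+);
   the record itself allows loops and multiple edges, which are excluded by
   [is_oriented_graph]. *)
Record pgraph := PGraph {
  vert : finType;
  edge : finType;
  src : edge -> vert;
  tgt : edge -> vert;
  pa : vert;
  pb : vert }.

Definition joins (G : pgraph) (e : edge G) (x y : vert G) : bool :=
  ((src e == x) && (tgt e == y)) || ((src e == y) && (tgt e == x)).

(* No loops, and at most one edge, with one orientation, between two given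
   vertices. *)
Definition is_oriented_graph (G : pgraph) : Prop :=
  (forall e : edge G, src e != tgt e) /\
  (forall (e f : edge G) (x y : vert G), joins e x y -> joins f x y -> e = f).

Definition adj (G : pgraph) (S : {set edge G}) : rel (vert G) :=
  fun x y => [exists e in S, joins e x y].

Definition is_connected (G : pgraph) : Prop :=
  forall x y : vert G, connect (adj [set: edge G]) x y.

(* Least length of a walk from x to y; equal to #|vert G| if there is none,
   while an existing shortest walk has length less than #|vert G|. *)
Definition gdist (G : pgraph) (x y : vert G) : nat :=
  find (fun n => [exists t : n.-tuple (vert G),
                    path (adj [set: edge G]) x t && (last x t == y)])
       (iota 0 #|vert G|).

Definition is_gpath (G : pgraph) (x : vert G) (s : seq (vert G)) (y : vert G)
    : bool :=
  [&& path (adj [set: edge G]) x s, last x s == y & uniq (x :: s)].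

Definition path_edges (G : pgraph) (x : vert G) (s : seq (vert G))
    : {set edge G} :=
  [set e | has (fun uv => joins e uv.1 uv.2) (zip (x :: s) s)].

Definition two_edge_disjoint_paths (G : pgraph) (x y : vert G) : Prop :=
  exists s1 s2 : seq (vert G),
    [/\ is_gpath x s1 y, is_gpath x s2 y
      & [disjoint path_edges x s1 & path_edges x s2]].

Definition admissible (G : pgraph) : Prop :=
  [/\ is_oriented_graph G, is_connected G, (1 < gdist (pa G) (pb G))%N
    & two_edge_disjoint_paths (pa G) (pb G)].

(* Product Bernoulli(p) weight of the configuration whose open edges are S. *)
Definition config_weight (R : realType) (G : pgraph) (p : R)
    (S : {set edge G}) : R :=
  \prod_(e : edge G) (if e \in S then p else 1 - p).

(* For p outside [0, 1] this is the polynomial extension. *)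
Definition crossing (R : realType) (G : pgraph) (p : R) : R :=
  \sum_(S : {set edge G} | connect (adj S) (pa G) (pb G)) config_weight p S.

Definition single_edge : pgraph :=
  @PGraph bool unit (fun=> false) (fun=> true) false true.

Definition inner (G : pgraph) : predArgType :=
  {v : vert G | v \notin [:: pa G; pb G]}.

(* Position of the vertex v of the copy of G that replaces the edge e of H:
   pa G goes to e_-, pb G to e_+, other vertices are fresh. *)
Definition glue (G H : pgraph) (e : edge H) (v : vert G)
    : (vert H + edge H * inner G)%type :=
  if insub v is Some w then inr (e, w)
  else inl (if v == pa G then src e else tgt e).

(* The operator Gamma associated with G, applied to H; the distinguished
   vertices are those of H. *)
Definition Gamma (G H : pgraph) : pgraph :=
  @PGraph (vert H + edge H * inner G)%type (edge H * edge G)%type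
    (fun ef => glue ef.1 (src ef.2)) (fun ef => glue ef.1 (tgt ef.2))
    (inl (pa H)) (inl (pb H)).

Lemma glue_inj (G H : pgraph) (e : edge H) :
  src e != tgt e -> injective (glue (G := G) e).
Proof.
move=> ne u v; rewrite /glue.
case: insubP => [w _ <-|Hu]; case: insubP => [w' _ <-|Hv] //.
- by case=> ->.
move: Hu Hv; rewrite !negbK !inE.
case: (u =P pa G) => [-> _|_ /eqP ->]; case: (v =P pa G) => [-> _|_ /= /eqP ->] //.
- by case=> E; rewrite E eqxx in ne.
- by case=> E; rewrite E eqxx in ne.
Qed.

Lemma glue_inner (G H : pgraph) (e : edge H) v : v \notin [:: pa G; pb G] ->
  exists w, glue (G := G) e v = inr (e, w).
Proof. by rewrite /glue; case: insubP => [w _ _ _|/negP //]; exists w. Qed.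

Lemma glue_inr (G H : pgraph) (e : edge H) v e' w :
  glue (G := G) e v = inr (e', w) -> e = e'.
Proof. by rewrite /glue; case: insubP => [? _ _ [] ->|_ //]. Qed.

Lemma joins_sym (G : pgraph) (e : edge G) x y : joins e x y = joins e y x.
Proof. by rewrite /joins orbC. Qed.

Lemma Gamma_oriented (G H : pgraph) :
  is_oriented_graph G -> ~~ adj [set: edge G] (pa G) (pb G) ->
  is_oriented_graph H -> is_oriented_graph (Gamma G H).
Proof.
move=> [G1 G2] nab [H1 H2]; split=> [[e f]|].
  by apply/negP => /eqP /(glue_inj (H1 e)) E; move: (G1 f); rewrite E eqxx.
have key (e e' : edge H) (f f' : edge G) x y :
    joins (G := Gamma G H) (e, f) x y -> joins (G := Gamma G H) (e', f') x y ->
    e = e'.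
  have inn : (src f \notin [:: pa G; pb G]) || (tgt f \notin [:: pa G; pb G]).
    apply: contraR nab; rewrite negb_or !negbK !inE => /andP [s t].
    apply/existsP; exists f; rewrite inE /joins /=; move: s t (G1 f).
    by move=> /orP [] /eqP -> /orP [] /eqP ->; rewrite ?eqxx ?orbT.
  have : exists w, x = inr (e, w) \/ y = inr (e, w) \/ ~~ joins (G := Gamma G H) (e, f) x y.
    case: (boolP (joins _ x y)) => [J|]; last first.
      by case/orP: inn => /(glue_inner e) [w _] _; exists w; right; right.
    by case/orP: inn => /(glue_inner e) [w Ew]; exists w; move: J; rewrite /joins /= Ew =>
      /orP [] /andP [] /eqP E1 /eqP E2; subst; auto.
  move=> [w Hw] J J'; move: Hw; rewrite J /=.
  by case=> [|[|//]] E; subst; move: J'; rewrite /joins /= => /orP [] /andP [] /eqP E1 /eqP E2;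
    apply/esym; first [exact: (glue_inr E1) | exact: (glue_inr E2)].
move=> [e f] [e' f'] x y J J'; have E := key _ _ _ _ _ _ J J'; subst e'.
congr pair; have gi := @glue_inj G H e (H1 e).
apply: (G2 _ _ (src f) (tgt f)); first by rewrite /joins !eqxx.
move: J J'; rewrite /joins /= => /orP [] /andP [] /eqP <- /eqP <-; rewrite !(inj_eq gi) //.
by rewrite orbC.
Qed.

Definition hybrid (Gl Gg : pgraph) (l g : nat) : pgraph :=
  iter l (Gamma Gl) (iter g (Gamma Gg) single_edge).

Definition unique_fixed_point (R : realType) (f : R -> R) (p : R) : Prop :=
  [/\ 0 < p < 1, f p = p & forall q : R, 0 < q < 1 -> f q = q -> q = p].

(* h is a C^1 diffeomorphism from (0, 1) onto R, with inverse hinv; values of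
   h outside (0, 1) are irrelevant. *)
Definition diffeo01 (R : realType) (h hinv : R -> R) : Prop :=
  [/\ (forall x : R, 0 < x < 1 -> hinv (h x) = x),
      (forall y : R, 0 < hinv y < 1 /\ h (hinv y) = y),
      (forall x : R, 0 < x < 1 -> derivable h x 1 /\ {for x, continuous (derive1 h)})
    & (forall y : R, derivable hinv y 1 /\ {for y, continuous (derive1 hinv)})].

(* Main.v *)
Require Import Defs.
From HB Require Import structures.
From mathcomp Require Import all_boot all_order all_algebra.
From mathcomp Require Import all_classical all_reals all_analysis.
From mathcomp Require Import ring lra.
From mathcomp Require polyrcf.
Set Implicit Arguments.
Unset Strict Implicit.
Unset Printing Implicit Defensive.
Import Order.TTheory GRing.Theory Num.Theory.
Import numFieldNormedType.Exports.
Local Open Scope ring_scope.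

(** Write f_l, f_g for the crossing probabilities of G^l, G^g and F^n for the
    n-th iterate of F.

    Substituting a copy of G for every edge of H turns crossing H into
    crossing H o crossing G: the copies are independent, and a copy acts as one
    edge which is open exactly when the copy is crossed ([crossing_Gamma]).
    Hence Phi_k = f_g^(g_k) o f_l^(l_k).

    Let gamma be the inverse of f_l on (0, 1), p_k = gamma^(l_k)(p_g) and
    zeta_k = zeta_g^(g_k) / D_k, where D_k is the derivative of gamma^(l_k) at
    p_g.  Put s_k = lambda / zeta_g^(g_k), which tends to 0.  If f_l^(l_k) is
    approximated to first order at p_k, then it maps p_k + lambda / zeta_k to
    about p_g + s_k; as h_g(p_g) = 0 and h_g'(p_g) = 1, the map h_g sends that
    point to about s_k, so h_g(Phi_k) = zeta_g^(g_k) h_g(f_l^(l_k)(...)) tends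
    to lambda, and the limit follows by continuity of the inverse of h_g.

    What has to be justified is that the first order approximation has a
    relative error that is small uniformly in l_k ([iter_horner_linear]).  This
    is bounded distortion.  Russo's formula gives f_l' > 0 on (0, 1)
    ([deriv_event_poly_gt0]), so one backward step is linear up to a
    relative error bounded by a multiple of the distance of its two points
    ([inv_step_linear]); the relative errors of the successive steps multiply,
    so it is enough that the sum of the distances between two backward orbits
    is small, uniformly in their length, when the initial points are close
    ([sum_orbit_dist_small]).  That holds because both orbits converge to p_l
    at a geometric rate: since p_l is the only fixed point in (0, 1) and is
    repelling, (f_l(x) - p_l) / (x - p_l) exceeds 1 on (0, 1)
    ([difference_quotient]).

    The same convergence gives p_k -> p_l.  Finally |log D_k| is at most
    proportional to l_k, so that log zeta_k = g_k log zeta_g + O(l_k). *)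

(** * Substituting a graph for the edges of another *)

Section Substitution.

Lemma joins_src_tgt (G : pgraph) (e : edge G) : joins e (src e) (tgt e).
Proof. by rewrite /joins !eqxx. Qed.

Lemma adj_sym (G : pgraph) (S : {set edge G}) : symmetric (adj S).
Proof. by move=> x y; apply: eq_existsb => e; rewrite joins_sym. Qed.

Lemma connect_adj_sym (G : pgraph) (S : {set edge G}) :
  connect_sym (adj S).
Proof. exact/sym_connect_sym/adj_sym. Qed.

Definition crosses (G : pgraph) (S : {set edge G}) : bool :=
  connect (adj S) (pa G) (pb G).

Lemma crosses_subset (G : pgraph) (S T : {set edge G}) :
  S \subset T -> crosses S -> crosses T.
Proof.
move=> /fintype.subsetP ST; apply: connect_sub => x y /existsP [e /andP [eS J]].
by apply: connect1; apply/existsP; exists e; rewrite ST.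
Qed.

Definition fiber (G H : pgraph) (S : {set edge (Gamma G H)}) (e : edge H) :
  {set edge G} := [set f | (e, f) \in S].

Definition crossed_copies (G H : pgraph) (S : {set edge (Gamma G H)}) :
  {set edge H} := [set e | crosses (fiber S e)].

Lemma glue_pa (G H : pgraph) (e : edge H) : Defs.glue e (pa G) = inl (src e).
Proof. by rewrite /Defs.glue insubF ?eqxx // inE eqxx. Qed.

Lemma glue_pb (G H : pgraph) (e : edge H) :
  pa G != pb G -> Defs.glue e (pb G) = inl (tgt e).
Proof.
move=> ne; rewrite /Defs.glue insubF; last by rewrite !inE eqxx orbT.
by rewrite eq_sym (negbTE ne).
Qed.

Lemma connect_glue (G H : pgraph) (S : {set edge (Gamma G H)}) (e : edge H) u v :
  connect (adj (fiber S e)) u v ->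
  connect (adj S) (Defs.glue (G := G) e u : vert (Gamma G H)) (Defs.glue e v).
Proof.
move=> /connectP [s]; elim: s u => [u _ -> //|w s IH u] /= /andP [uw ws] E.
apply: connect_trans (IH _ ws E); apply: connect1.
case/existsP: uw => f /andP []; rewrite inE => fS J.
apply/existsP; exists (e, f); rewrite fS /=.
by case/orP: J => /andP [/eqP <- /eqP <-]; rewrite /joins !eqxx ?orbT.
Qed.

(** Reachability from [inl x0] of the point [v] of the copy replacing [e],
    expressed without paths in the substituted graph: an open path to [v]
    enters that copy for the last time through one of its two ends. *)
Definition reach (G H : pgraph) (S : {set edge (Gamma G H)}) (x0 : vert H)
    (e : edge H) (v : vert G) : bool :=
  (connect (adj (fiber S e)) (pa G) v
     && connect (adj (crossed_copies S)) x0 (src e))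
  || (connect (adj (fiber S e)) (pb G) v
     && connect (adj (crossed_copies S)) x0 (tgt e)).

Definition reached (G H : pgraph) (S : {set edge (Gamma G H)}) (x0 : vert H)
    (z : vert (Gamma G H)) : bool :=
  match z with
  | inl x => connect (adj (crossed_copies S)) x0 x
  | inr (e, w) => reach S x0 e (val w)
  end.

Lemma crossed_connect (G H : pgraph) (S : {set edge (Gamma G H)}) (x0 : vert H)
    (e : edge H) : crosses (fiber S e) ->
  connect (adj (crossed_copies S)) x0 (src e) =
  connect (adj (crossed_copies S)) x0 (tgt e).
Proof.
move=> C; rewrite !(connect_adj_sym _ x0); apply: same_connect.
  exact: connect_adj_sym.
by apply: connect1; apply/existsP; exists e; rewrite inE C joins_src_tgt.
Qed.

(** The definition of [reached] on a vertex of H agrees with [reach] in every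
    copy that touches this vertex: if the two ends of the copy are connected
    inside it, then the edge is crossed and both ends have the same status. *)
Lemma reached_glue (G H : pgraph) (S : {set edge (Gamma G H)}) (x0 : vert H)
    (e : edge H) (v : vert G) : pa G != pb G ->
  reached S x0 (Defs.glue e v) = reach S x0 e v.
Proof.
move=> ne; have [->|va] := eqVneq v (pa G).
  rewrite glue_pa /= /reach connect0 /=.
  case: (boolP (connect _ (pb G) _)) => [|_]; last by rewrite orbF.
  rewrite connect_adj_sym => C.
  by rewrite -(crossed_connect x0 C) orbb.
have [->|vb] := eqVneq v (pb G).
  rewrite glue_pb //= /reach connect0 /=.
  case: (boolP (connect _ (pa G) _)) => [C|//].
  by rewrite -(crossed_connect x0 C) orbb.
rewrite /Defs.glue; case: insubP => [w _ <- //|].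
by rewrite !inE (negbTE va) (negbTE vb).
Qed.

Lemma reach_adj (G H : pgraph) (S : {set edge (Gamma G H)}) (x0 : vert H)
    (e : edge H) (u v : vert G) :
  adj (fiber S e) u v -> reach S x0 e u = reach S x0 e v.
Proof.
move=> /connect1 C.
have E a : connect (adj (fiber S e)) a u = connect (adj (fiber S e)) a v.
  rewrite !(connect_adj_sym _ a); apply: same_connect => //.
  exact: connect_adj_sym.
by rewrite /reach !E.
Qed.

Lemma reached_closed (G H : pgraph) (S : {set edge (Gamma G H)}) (x0 : vert H) :
  pa G != pb G -> fingraph.closed (adj S) (reached S x0).
Proof.
move=> ne x y /existsP [[e f] /andP [efS J]].
have E : reached S x0 (Defs.glue e (src f)) = reached S x0 (Defs.glue e (tgt f)).
  rewrite !reached_glue //; apply: reach_adj.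
  by apply/existsP; exists f; rewrite inE efS joins_src_tgt.
rewrite -[LHS]/(reached S x0 x) -[RHS]/(reached S x0 y).
by case/orP: J => /andP [/eqP <- /eqP <-].
Qed.

(** From left to right, [reached] is a set that contains [x] and that no open
    edge leaves; from right to left, each crossed copy supplies a path. *)
Lemma connect_Gamma (G H : pgraph) (S : {set edge (Gamma G H)}) (x y : vert H) :
  pa G != pb G ->
  connect (adj S) (inl x : vert (Gamma G H)) (inl y) =
  connect (adj (crossed_copies S)) x y.
Proof.
move=> ne; apply/idP/idP => [|/connectP [s]].
  move=> /(fingraph.closed_connect (reached_closed x ne)).
  by rewrite !unfold_in /= connect0.
elim: s x => [x _ -> //|z s IH x] /= /andP [xz zs] E.
apply: connect_trans (IH _ zs E).
case/existsP: xz => e /andP []; rewrite inE => /connect_glue.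
rewrite glue_pa glue_pb // => C.
case/orP => /andP [/eqP <- /eqP <-] //.
by rewrite connect_adj_sym.
Qed.

Lemma crossingE (R : realType) (G : pgraph) (p : R) :
  crossing G p = \sum_(S : {set edge G} | crosses S) config_weight p S.
Proof. by []. Qed.

Lemma sum_config_weight (R : realType) (G : pgraph) (p : R) :
  \sum_(S : {set edge G}) config_weight p S = 1.
Proof.
transitivity (\prod_(e : edge G) \sum_(b : bool) (if b then p else 1 - p)).
  rewrite bigA_distr_bigA /=.
  rewrite (reindex (fun f : {ffun edge G -> bool} => [set e | f e])) /=.
    by apply: eq_bigr => f _; apply: eq_bigr => e _; rewrite inE.
  exists (fun S : {set edge G} => [ffun e => e \in S]) => [f _|S _].
    by apply/ffunP => e; rewrite ffunE inE.
  by apply/setP => e; rewrite inE ffunE.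
by rewrite big1 // => e _; rewrite big_bool /= addrC subrK.
Qed.

(** A configuration on the substituted graph is a family of independent
    configurations on the copies; grouping these families by the set of crossed
    copies, a product of sums over the copies factors out of each group. *)
Lemma crossing_Gamma (R : realType) (G H : pgraph) (p : R) :
  pa G != pb G -> crossing (Gamma G H) p = crossing H (crossing G p).
Proof.
move=> ne; rewrite !crossingE.
pose tofun (S : {set edge (Gamma G H)}) := [ffun e : edge H => fiber S e].
pose toset (f : {ffun edge H -> {set edge G}}) :=
  [set ef : edge (Gamma G H) | ef.2 \in f ef.1].
have tofunK : cancel toset tofun.
  by move=> f; apply/ffunP => e; apply/setP => x; rewrite ffunE !inE.
have tosetK : cancel tofun toset.
  by move=> S; apply/setP => -[e x]; rewrite inE ffunE inE.
pose copies (f : {ffun edge H -> {set edge G}}) := [set e | crosses (f e)].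
transitivity (\sum_(f : {ffun edge H -> {set edge G}} | crosses (copies f))
    \prod_e config_weight p (f e)).
  rewrite (reindex toset) /=; last by exists tofun => ? _; rewrite ?tofunK ?tosetK.
  apply: eq_big => [f|f _].
    rewrite /crosses connect_Gamma //; congr connect; congr adj.
    by apply/setP => e; rewrite !inE -[in RHS](tofunK f) ffunE.
  rewrite /config_weight pair_big /=.
  by apply: eq_bigr => -[e x] _; rewrite inE.
rewrite (partition_big copies (@crosses H)) //=.
apply: eq_bigr => T CT; rewrite /config_weight.
have E e : (if e \in T then crossing G p else 1 - crossing G p) =
    \sum_(S : {set edge G} | crosses S == (e \in T)) config_weight p S.
  rewrite -(sum_config_weight G p) (bigID (@crosses G)) /= -crossingE addrC addrK.
  by case: (e \in T); rewrite ?crossingE; apply: eq_bigl => S; case: (crosses S).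
rewrite (eq_bigr _ (fun e _ => E e)) bigA_distr_big_dep.
apply: eq_bigl => f; apply/andP/familyP => [[_ /eqP <-] e|F].
  by rewrite unfold_in inE.
have -> : copies f = T.
  by apply/setP => e; move: (F e); rewrite inE unfold_in => /eqP.
by rewrite CT.
Qed.

Lemma crossing_iter_Gamma (R : realType) (G H : pgraph) (n : nat) (p : R) :
  pa G != pb G ->
  crossing (iter n (Gamma G) H) p = crossing H (iter n (@crossing R G) p).
Proof.
by move=> ne; elim: n p => //= n IH p; rewrite crossing_Gamma // IH -iterSr.
Qed.

Lemma crossing_single_edge (R : realType) (p : R) : crossing single_edge p = p.
Proof.
rewrite crossingE (big_pred1 [set tt]) => [|S /=].
  by rewrite /config_weight (big_pred1 tt) ?inE // => -[].
apply/idP/eqP => [/connectP [[|y s] //= /andP [/existsP [[] /andP [tS _]] _] _]|->].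
  by apply/setP => -[]; rewrite tS inE.
by apply: connect1; apply/existsP; exists tt; rewrite inE /joins /=.
Qed.

Lemma crossing_hybrid (R : realType) (Gl Gg : pgraph) (l g : nat) (p : R) :
  pa Gl != pb Gl -> pa Gg != pb Gg ->
  crossing (hybrid Gl Gg l g) p =
  iter g (@crossing R Gg) (iter l (@crossing R Gl) p).
Proof.
by move=> nl ng; rewrite /hybrid !crossing_iter_Gamma // crossing_single_edge.
Qed.

Lemma admissible_neq (G : pgraph) : admissible G -> pa G != pb G.
Proof.
case=> _ _ d _; apply: contraTneq d => ->; rewrite /gdist.
have : (0 < #|vert G|)%N by apply/card_gt0P; exists (pb G).
case: #|vert G| => // n _ /=.
by case: existsP => // -[]; exists [tuple]; rewrite /= eqxx.
Qed.

End Substitution.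

(** * Monotone events and Russo's formula *)

Section Events.
Variables (R : realType) (E : finType).

Definition event_poly (A : pred {set E}) : {poly R} :=
  \sum_(S : {set E} | A S) \prod_(e : E) (if e \in S then 'X else 1 - 'X).

Lemma deriv_prod_seq (I : eqType) (r : seq I) (F : I -> {poly R}) : uniq r ->
  (\prod_(i <- r) F i)^`() =
  \sum_(i <- r) (F i)^`() * \prod_(j <- r | j != i) F j.
Proof.
elim: r => [_|i r IH /= /andP [ir ur]]; first by rewrite !big_nil derivC.
rewrite !big_cons derivM IH // eqxx mulr_sumr; congr (_ * _ + _).
  rewrite [LHS]big_seq [RHS]big_seq_cond; apply: eq_bigl => j.
  by case: eqVneq => [->|]; rewrite ?(negbTE ir) ?andbT.
rewrite [LHS]big_seq [RHS]big_seq; apply: eq_bigr => j jr.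
rewrite big_cons ifT; last by apply: contraNneq ir => ->.
by rewrite mulrCA.
Qed.

Lemma horner_event_poly (A : pred {set E}) (x : R) :
  (event_poly A).[x] =
  \sum_(S : {set E} | A S) \prod_(e : E) (if e \in S then x else 1 - x).
Proof.
rewrite horner_sum; apply: eq_bigr => S _; rewrite horner_prod.
by apply: eq_bigr => e _; case: ifP; rewrite ?hornerD ?hornerN ?hornerX ?hornerC.
Qed.

Definition pivotal (A : pred {set E}) (e : E) (T : {set E}) : bool :=
  [&& e \notin T, A (e |: T) & ~~ A T].

(** Russo's formula.  In the derivative in the direction of [e], the
    configurations containing [e] count positively and the others negatively,
    with weights that ignore [e]; [T] and [e |: T] therefore cancel unless
    exactly one of them, necessarily the latter, lies in the event. *)
Lemma russo (A : pred {set E}) (x : R) :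
  (forall S T : {set E}, S \subset T -> A S -> A T) ->
  (event_poly A)^`().[x] =
  \sum_(e : E) \sum_(T | pivotal A e T)
    \prod_(e' | e' != e) (if e' \in T then x else 1 - x).
Proof.
move=> monoA.
transitivity (\sum_(e : E) \sum_(S : {set E} | A S) (if e \in S then 1 else -1) *
   \prod_(e' | e' != e) (if e' \in S then x else 1 - x)).
  rewrite exchange_big /= raddf_sum horner_sum; apply: eq_bigr => S _.
  rewrite /= deriv_prod_seq ?index_enum_uniq // horner_sum; apply: eq_bigr => e _.
  rewrite hornerM horner_prod; congr (_ * _).
    by case: ifP => _; rewrite ?derivB ?derivX ?derivC ?sub0r ?hornerN hornerC.
  by apply: eq_bigr => f _; case: ifP; rewrite ?hornerD ?hornerN ?hornerX ?hornerC.
apply: eq_bigr => e _.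
set W := fun S : {set E} => \prod_(e' | e' != e) (if e' \in S then x else 1 - x).
rewrite (bigID (fun S : {set E} => e \in S)) /=.
rewrite [X in _ + X = _](_ : _ = - \sum_(S | A S && (e \notin S)) W S); last first.
  by rewrite -sumrN; apply: eq_bigr => S /andP [_ /negbTE ->]; rewrite mulN1r.
rewrite (reindex_onto (fun T => e |: T) (fun S => S :\ e)) /=; last first.
  by move=> S /andP [_ eS]; rewrite finset.setD1K.
rewrite (eq_bigl (fun T => A (e |: T) && (e \notin T))); last first.
  move=> T; rewrite finset.setU11 andbT; congr andb.
  apply/eqP/idP => [<-|eT]; first by rewrite finset.setD11.
  by rewrite finset.setU1K.
rewrite (eq_bigr W); last first.
  move=> T _; rewrite finset.setU11 mul1r; apply: eq_bigr => f /negbTE fe.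
  by rewrite !inE fe.
rewrite (bigID A) /= [X in X + _ - _](_ : _ = \sum_(S | A S && (e \notin S)) W S).
  rewrite addrAC subrr add0r; apply: eq_bigl => T.
  by rewrite /pivotal andbA [X in X && _]andbC.
apply: eq_bigl => T; case: (boolP (A T)) => AT; rewrite ?andbF // ?andbT.
by rewrite (monoA T) // finset.subsetUr.
Qed.

(** Add any missing edge to a largest configuration outside the event. *)
Lemma exists_pivotal (A : pred {set E}) :
  ~~ A finset.set0 -> A [set: E] -> exists e T, pivotal A e T.
Proof.
move=> A0 A1; have [T /= AT maxT] := arg_maxnP (P := fun S => ~~ A S) (fun S : {set E} => #|S|) A0.
have /fintype.properP [_ [e _ eT]] : T \proper [set: E].
  by rewrite finset.properT; apply: contraNneq AT => ->.
exists e, T; rewrite /pivotal eT AT andbT /=.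
by apply: contraT => /maxT; rewrite /= finset.cardsU1 eT /= add1n ltnn.
Qed.

Lemma deriv_event_poly_gt0 (A : pred {set E}) (x : R) :
  (forall S T : {set E}, S \subset T -> A S -> A T) ->
  ~~ A finset.set0 -> A [set: E] -> 0 < x < 1 -> 0 < (event_poly A)^`().[x].
Proof.
move=> monoA A0 A1 /andP [x0 x1]; rewrite russo //.
have W0 (e : E) (T : {set E}) :
    0 < \prod_(e' | e' != e) (if e' \in T then x else 1 - x).
  by apply: prodr_gt0 => f _; case: ifP; rewrite ?subr_gt0.
have [e [T piv]] := exists_pivotal A0 A1.
rewrite (bigD1 e) //= (bigD1 T) //= -addrA ltr_pwDl //.
apply: addr_ge0; first by apply: sumr_ge0 => *; exact: ltW.
by do 2 (apply: sumr_ge0 => * ); exact: ltW.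
Qed.

Lemma event_poly_at0 (A : pred {set E}) : ~~ A finset.set0 -> (event_poly A).[0] = 0.
Proof.
move=> A0; rewrite horner_event_poly big1 // => S AS.
have /finset.set0Pn [e eS] : S != finset.set0 by apply: contraNneq A0 => <-.
by rewrite (bigD1 e) //= eS mul0r.
Qed.

Lemma event_poly_at1 (A : pred {set E}) : A [set: E] -> (event_poly A).[1] = 1.
Proof.
move=> A1; rewrite horner_event_poly (bigD1 [set: E]) //=.
rewrite [X in X + _]big1 => [|e _]; last by rewrite inE.
rewrite big1 ?addr0 // => S /andP [_ ST].
have /fintype.properP [_ [e _ eS]] : S \proper [set: E] by rewrite finset.properT.
by rewrite (bigD1 e) //= (negbTE eS) subrr mul0r.
Qed.

End Events.

Section CrossingPolynomial.
Variables (R : realType) (G : pgraph).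

Definition crossing_poly : {poly R} := event_poly R (@crosses G).

Lemma crossing_horner : @crossing R G = horner crossing_poly.
Proof. by apply/funext => p; rewrite horner_event_poly. Qed.

Lemma crosses_set0 : pa G != pb G -> ~~ crosses (finset.set0 : {set edge G}).
Proof.
apply: contraNN => /connectP [[|x s] /=]; first by move=> _ ->.
by case/andP => /existsP [e]; rewrite inE.
Qed.

Lemma crossing_poly_admissible : admissible G ->
  [/\ crossing_poly.[0] = 0, crossing_poly.[1] = 1 &
      forall x, 0 < x < 1 -> 0 < crossing_poly^`().[x]].
Proof.
move=> HG; have ne := admissible_neq HG; case: HG => _ conn _ _.
have C1 : crosses [set: edge G] by exact: conn.
split=> [||x x01]; first exact/event_poly_at0/crosses_set0.
  exact: event_poly_at1.
by apply: deriv_event_poly_gt0 => //; [exact: crosses_subset|exact: crosses_set0].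
Qed.

End CrossingPolynomial.

(** * Backward iteration towards a repelling fixed point *)

Section InverseBranch.
Variables (R : realType) (P : {poly R}) (c : R).
Hypotheses (P0 : P.[0] = 0) (P1 : P.[1] = 1).
Hypothesis dP_gt0 : forall x, 0 < x < 1 -> 0 < P^`().[x].
Hypothesis fixc : unique_fixed_point (horner P) c.
Hypothesis dPc : 1 < P^`().[c].

Lemma horner_lt (u v : R) : 0 <= u -> u < v -> v <= 1 -> P.[u] < P.[v].
Proof.
move=> u0 uv v1; have [x] := polyrcf.poly_mvt P uv; rewrite in_itv /= => /andP [ux xv] E.
rewrite -subr_gt0 E mulr_gt0 ?subr_gt0 // dP_gt0 //.
by rewrite (le_lt_trans u0) // (lt_le_trans xv).
Qed.

Lemma horner01 (x : R) : 0 < x < 1 -> 0 < P.[x] < 1.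
Proof.
move=> /andP [x0 x1]; rewrite -[X in X < _ < _]P0 -[X in _ < _ < X]P1.
by rewrite !horner_lt // ltW.
Qed.

Lemma iter_horner01 n (x : R) : 0 < x < 1 -> 0 < iter n (horner P) x < 1.
Proof. by move=> x01; elim: n => //= n; apply: horner01. Qed.

Lemma iter_horner_lt n (u v : R) : 0 < u < 1 -> 0 < v < 1 -> u < v ->
  iter n (horner P) u < iter n (horner P) v.
Proof.
move=> u01 v01 uv; elim: n => //= n IH.
have /andP [? _] := iter_horner01 n u01; have /andP [_ ?] := iter_horner01 n v01.
by apply: horner_lt => //; apply: ltW.
Qed.

Lemma iter_horner_le n (u v : R) : 0 < u < 1 -> 0 < v < 1 -> u <= v ->
  iter n (horner P) u <= iter n (horner P) v.
Proof.
move=> u01 v01; rewrite le_eqVlt => /orP [/eqP -> //|uv].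
exact/ltW/iter_horner_lt.
Qed.

Definition inv_branch (y : R) : R :=
  xget 0 [set x : R | 0 < x < 1 /\ P.[x] = y]%classic.
Local Notation g := inv_branch.

Lemma inv_branchP (y : R) : 0 < y < 1 -> 0 < g y < 1 /\ P.[g y] = y.
Proof.
move=> /andP [y0 y1].
suff /(xgetPex 0) : exists x : R, 0 < x < 1 /\ P.[x] = y by [].
have [|x /andP [x0 x1]] := @poly_ivt R (P - y%:P) 0 1 ler01.
  by rewrite !hornerD !hornerN !hornerC P0 P1 sub0r oppr_le0 subr_ge0 !ltW.
rewrite /root hornerD hornerN hornerC subr_eq0 => /eqP E; exists x; split => //.
rewrite !lt_neqAle x0 x1 !andbT; apply/andP; split.
  by apply: contraTneq y0 => x0'; rewrite -E -x0' P0 ltxx.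
by apply: contraTneq y1 => x1'; rewrite -E x1' P1 ltxx.
Qed.

Lemma inv_branch01 (y : R) : 0 < y < 1 -> 0 < g y < 1.
Proof. by case/inv_branchP. Qed.

Lemma inv_branchK (y : R) : 0 < y < 1 -> P.[g y] = y.
Proof. by case/inv_branchP. Qed.

Lemma iter_inv_branch01 n (y : R) : 0 < y < 1 -> 0 < iter n g y < 1.
Proof. by move=> y01; elim: n => //= n; apply: inv_branch01. Qed.

Lemma iter_inv_branchK n (y : R) :
  0 < y < 1 -> iter n (horner P) (iter n g y) = y.
Proof.
move=> y01; elim: n => // n IH.
by rewrite iterSr [iter n.+1 g y]/= inv_branchK ?iter_inv_branch01.
Qed.

Lemma inv_branch_le (y z : R) : 0 < y < 1 -> 0 < z < 1 -> y <= z -> g y <= g z.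
Proof.
move=> y01 z01; apply: contraTle => zy; rewrite -ltNge.
have /andP [? ?] := inv_branch01 y01; have /andP [? ?] := inv_branch01 z01.
by rewrite -(inv_branchK y01) -(inv_branchK z01) horner_lt // ltW.
Qed.

Lemma c_bounds : 0 < c < 1. Proof. by case: fixc. Qed.
Lemma horner_c : P.[c] = c. Proof. by case: fixc. Qed.

Lemma inv_branch_fix : g c = c.
Proof.
have c01 := c_bounds; have /andP [c0 c1] := c01.
have /andP [? ?] := inv_branch01 c01; have E := inv_branchK c01.
apply/eqP; case: (ltgtP (g c) c) => // lt.
  by have := horner_lt (ltW _) lt (ltW c1); rewrite E horner_c ltxx => ->.
by have := horner_lt (ltW c0) lt (ltW _); rewrite E horner_c ltxx => ->.
Qed.

(** The quotient of [P - c] by ['X - c] takes the value P'(c) > 1 at [c]; if it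
    were at most 1 somewhere in (0, 1), then it would be 1 at some point, which
    would be a second fixed point. *)
Lemma difference_quotient : exists2 Q : {poly R},
  (forall x, P.[x] - c = Q.[x] * (x - c)) & (forall x, 0 < x < 1 -> 1 < Q.[x]).
Proof.
have /factor_theorem [Q EQ] : root (P - c%:P) c.
  by rewrite /root hornerD hornerN hornerC horner_c subrr.
have QE x : P.[x] - c = Q.[x] * (x - c).
  have /(congr1 (horner^~ x)) := EQ.
  by rewrite hornerM hornerXsubC hornerD hornerN hornerC.
exists Q => //; have Qc : 1 < Q.[c].
  suff -> : Q.[c] = P^`().[c] by [].
  have /(congr1 (fun p => p^`().[c])) := EQ.
  rewrite derivB derivC subr0 derivM derivXsubC mulr1 hornerD hornerM.
  by rewrite hornerXsubC subrr mulr0 add0r.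
have [/andP [c0 c1] _ uniqc] := fixc.
have noroot z : 0 < z < 1 -> Q.[z] != 1.
  move=> z01; apply: contraTneq Qc => Qz.
  have /eqP : P.[z] = z by move: (QE z); rewrite Qz mul1r => /addIr.
  by move=> /eqP /(uniqc _ z01) <-; rewrite Qz ltxx.
move=> x x01; rewrite ltNge; apply/negP => Qx; have /andP [x0 x1] := x01.
case: (leP x c) => xc.
  have [|z /andP [xz zc]] := @poly_ivt R (Q - 1) x c xc.
    by rewrite !hornerD !hornerN !hornerC subr_le0 Qx subr_ge0 ltW.
  rewrite /root hornerD hornerN hornerC subr_eq0; apply/negP/noroot.
  by rewrite (lt_le_trans x0) // (le_lt_trans zc).
have [|z /andP [cz zx]] := @poly_ivt R (1 - Q) c x (ltW xc).
  by rewrite !hornerD !hornerN !hornerC subr_le0 subr_ge0 Qx andbT ltW.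
rewrite /root hornerD hornerN hornerC subr_eq0 eq_sym; apply/negP/noroot.
by rewrite (lt_le_trans c0) // (le_lt_trans zx).
Qed.

Lemma poly_min_gt (Q : {poly R}) (a b m : R) :
  a <= b -> (forall x, a <= x <= b -> m < Q.[x]) ->
  exists2 m', m < m' & forall x, a <= x <= b -> m' <= Q.[x].
Proof.
move=> ab Qm.
have [|t] := @EVT_min R (horner Q) a b ab.
  by apply/continuous_subspaceT => x; exact: continuous_horner.
rewrite in_itv /= => /Qm mQ minQ; exists Q.[t] => // x xab; apply: minQ.
Qed.

Lemma poly_mvt_near (Q : {poly R}) (a b u v : R) :
  a <= u <= b -> a <= v <= b ->
  exists2 x, (a <= x <= b) && (`|x - v| <= `|u - v|) &
    Q.[u] - Q.[v] = Q^`().[x] * (u - v).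
Proof.
move=> /andP [au ub] /andP [av vb]; have [->|nuv] := eqVneq u v.
  by exists v; rewrite ?av ?vb ?subrr ?mulr0 ?lexx.
have [uv|vu] := ltP u v.
  have [x] := polyrcf.poly_mvt Q uv; rewrite in_itv /= => /andP [ux xv] E.
  exists x; last by rewrite -opprB E -mulrN opprB.
  rewrite !ltr0_norm ?subr_lt0 //; apply/andP; split; [apply/andP; split|]; lra.
have {}vu : v < u by rewrite lt_neqAle eq_sym nuv.
have [x] := polyrcf.poly_mvt Q vu; rewrite in_itv /= => /andP [ux xv] E.
exists x => //; rewrite !gtr0_norm ?subr_gt0 //; apply/andP; split; [apply/andP; split|]; lra.
Qed.

(** On a compact interval [a, b] of (0, 1) containing the fixed point, the
    derivative is bounded away from 0 and the inverse branch maps the interval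
    to itself. *)
Section Window.
Variables (a b : R).
Hypotheses (a_gt0 : 0 < a) (ac : a <= c) (cb : c <= b) (b_lt1 : b < 1).

Lemma window01 (x : R) : a <= x <= b -> 0 < x < 1.
Proof.
by move=> /andP [ax xb]; rewrite (lt_le_trans a_gt0 ax) (le_lt_trans xb b_lt1).
Qed.

Lemma inv_branch_contracts : exists2 r : R, 0 < r < 1 &
  forall y, 0 < y < 1 -> a <= g y <= b -> `|g y - c| <= r * `|y - c|.
Proof.
have [Q QE Q1] := difference_quotient.
have [|m m1 mQ] := @poly_min_gt Q a b 1 (le_trans ac cb).
  by move=> x /window01 /Q1.
have m0 : 0 < m by lra.
exists m^-1; first by rewrite invr_gt0 m0 invf_lt1.
move=> y y01 /mQ mg; rewrite -{2}(inv_branchK y01) QE normrM mulrA.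
rewrite ler_peMl // ler_pdivlMl // mulr1; apply: le_trans (ler_norm _) => //.
Qed.

(** A backward step moves a point towards [c] without passing it. *)
Lemma inv_branch_window (y : R) : a <= y <= b -> a <= g y <= b.
Proof.
move=> yab; have y01 := window01 yab; have /andP [ay yb] := yab.
have [ac' cb'] := (ac, cb).
have [Q QE Q1] := difference_quotient.
have := Q1 _ (inv_branch01 y01); have := QE (g y); rewrite inv_branchK // => E Qg.
have [cy|yc] := leP c y.
  have := inv_branch_le c_bounds y01 cy; rewrite inv_branch_fix => cg.
  have : g y - c <= y - c by rewrite E ler_peMl ?subr_ge0 // ltW.
  by move=> H; apply/andP; split; lra.
have := inv_branch_le y01 c_bounds (ltW yc); rewrite inv_branch_fix => cg.
have : c - g y <= c - y by rewrite -(opprB y c) E -mulrN opprB ler_peMl ?subr_ge0 // ltW.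
by move=> H; apply/andP; split; lra.
Qed.

Lemma iter_inv_branch_window n (y : R) : a <= y <= b -> a <= iter n g y <= b.
Proof. by move=> yab; elim: n => //= n; apply: inv_branch_window. Qed.

Lemma iter_inv_branch_contracts : exists2 r : R, 0 < r < 1 &
  forall n y, a <= y <= b -> `|iter n g y - c| <= r ^+ n * `|y - c|.
Proof.
have [r r01 Hr] := inv_branch_contracts; exists r => // n y yab.
elim: n => [|n IH]; first by rewrite mul1r.
have /andP [r0 _] := r01; have wn := iter_inv_branch_window n yab.
rewrite exprS -mulrA; apply: le_trans (ler_wpM2l (ltW r0) IH).
by apply: Hr; rewrite ?window01 //; apply: (iter_inv_branch_window n.+1).
Qed.

Lemma deriv_bounds : exists2 m : R, 0 < m < 1 &
  forall x, a <= x <= b -> m <= P^`().[x] <= m^-1.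
Proof.
have [|m m0 mP] := @poly_min_gt P^`() a b 0 (le_trans ac cb).
  by move=> x /window01 /dP_gt0.
have [B PB] := poly_itv_bound P^`() a b.
have B0 : 0 <= B by apply: le_trans (PB c _) => //; rewrite ac cb.
have B2 : 0 < B + 2 by lra.
exists (Num.min m (B + 2)^-1).
  rewrite lt_min m0 invr_gt0 B2 /= gt_min; apply/orP; right.
  by rewrite invf_lt1 //; lra.
move=> x xab; rewrite ge_min mP //=.
have : P^`().[x] <= B + 2.
  by apply: le_trans (le_trans (ler_norm _) (PB x xab)) _; lra.
move=> H; apply: (le_trans H); rewrite -[leLHS]invrK lef_pV2 ?ge_min ?lexx ?orbT //.
  by rewrite posrE invr_gt0.
by rewrite posrE lt_min m0 invr_gt0.
Qed.

(** With [u] and [v] the images under the inverse branch of two points, this is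
    the linearity of one backward step: 1 + e is the ratio of P'(v) to the slope
    P'(x) at an intermediate point, and P' is Lipschitz. *)
Lemma inv_step_linear : exists2 L : R, 0 < L &
  forall u v, a <= u <= b -> a <= v <= b ->
  exists2 e : R, (u - v) * P^`().[v] = (P.[u] - P.[v]) * (1 + e)
    & `|e| <= L * `|u - v|.
Proof.
have [m /andP [m0 m1] mP] := deriv_bounds.
have [B PB] := poly_itv_bound (P^`())^`() a b.
have B0 : 0 <= B by apply: le_trans (PB c _) => //; rewrite ac cb.
exists (B / m + 1) => [|u v uab vab].
  by rewrite ltr_wpDl // divr_ge0 // ltW.
have [x /andP [xab xv] E] := poly_mvt_near P uab vab.
have [y /andP [yab _] F] := poly_mvt_near P^`() xab vab.
have /andP [mx _] := mP x xab; have Px : 0 < P^`().[x] := lt_le_trans m0 mx.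
have Pxn : P^`().[x] != 0 by rewrite gt_eqF.
exists (P^`().[v] / P^`().[x] - 1).
  by rewrite E; field.
rewrite -[X in _ - X](divff Pxn) -mulrBl -opprB mulNr normrN F.
rewrite !normrM normfV [`|P^`().[x]|]gtr0_norm //.
rewrite mulrAC; apply: ler_pM => //.
  by rewrite mulr_ge0 // invr_ge0 ltW.
apply: (@le_trans _ _ (B / m)); last by rewrite lerDl.
by apply: ler_pM; rewrite ?PB ?invr_ge0 ?(ltW Px) // lef_pV2 // posrE.
Qed.

(** The derivative at [q] of the [n]-th iterate of the inverse branch, by the
    chain rule. *)
Definition inv_slope (n : nat) (q : R) : R :=
  \prod_(j < n) (P^`().[iter j.+1 g q])^-1.

Lemma inv_slopeS n (q : R) :
  inv_slope n.+1 q = inv_slope n q * (P^`().[iter n.+1 g q])^-1.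
Proof. exact: big_ord_recr. Qed.

Lemma inv_slope_gt0 n (q : R) : 0 < q < 1 -> 0 < inv_slope n q.
Proof.
move=> q01; apply: prodr_gt0 => j _; rewrite invr_gt0 dP_gt0 //.
exact: iter_inv_branch01 j.+1 q q01.
Qed.

Definition orbit_dist (y q : R) (n : nat) : R :=
  `|iter n g y - iter n g q|.

Lemma orbit_dist_lipschitz : exists2 K : R, 1 <= K &
  forall n y q, a <= y <= b -> a <= q <= b ->
  orbit_dist y q n <= K ^+ n * `|y - q|.
Proof.
have [m /andP [m0 m1] mP] := deriv_bounds; exists m^-1.
  by rewrite invf_ge1 // ltW.
move=> n y q yab qab; elim: n => [|n IH]; first by rewrite mul1r.
have uab := iter_inv_branch_window n.+1 yab.
have vab := iter_inv_branch_window n.+1 qab.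
have [x /andP [xab _]] := poly_mvt_near P uab vab.
rewrite !inv_branchK ?window01 ?iter_inv_branch_window // => E.
rewrite exprS -mulrA; apply: (@le_trans _ _ (m^-1 * orbit_dist y q n)).
  rewrite ler_pdivlMl // /orbit_dist E normrM.
  apply: ler_wpM2r => //; apply: le_trans (ler_norm _).
  by case/andP: (mP x xab).
by rewrite ler_pM2l // invr_gt0.
Qed.

Lemma sum_geometric_le (r : R) n : 0 < r < 1 ->
  \sum_(i < n) r ^+ i <= (1 - r)^-1.
Proof.
move=> /andP [r0 r1]; have d0 : 0 < 1 - r by rewrite subr_gt0.
rewrite -[leRHS]mul1r ler_pdivlMr // mulrC -opprB mulNr -subrX1 opprB.
by rewrite gerBl exprn_ge0 // ltW.
Qed.

(** The terms of large index are small uniformly, both orbits being close to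
    [c]; the finitely many others are at most a constant times the initial
    distance. *)
Lemma sum_orbit_dist_small (eps : R) : 0 < eps -> exists2 eta : R, 0 < eta &
  forall y q, a <= y <= b -> a <= q <= b -> `|y - q| <= eta ->
  forall n, \sum_(j < n) orbit_dist y q j.+1 <= eps.
Proof.
move=> eps0; have [K K1 HK] := orbit_dist_lipschitz.
have [r r01 Hr] := iter_inv_branch_contracts; have /andP [r0 r1] := r01.
have d0 : 0 < 1 - r by rewrite subr_gt0.
have e0 : 0 < eps * (1 - r) / 4 by rewrite divr_gt0 // mulr_gt0.
have r1' : `|r| < 1 by rewrite ger0_norm // ltW.
have /cvgrPdist_le /(_ _ e0) [N _ HN] := cvg_expr r1'.
have {HN} rN : r ^+ N <= eps * (1 - r) / 4.
  have := HN N (leqnn N); rewrite /= sub0r normrN ger0_norm // exprn_ge0 //.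
  exact: ltW.
have K0 : 0 < K by apply: lt_le_trans K1.
pose A := N%:R * K ^+ N + 1.
have A0 : 0 < A by rewrite ltr_wpDl // mulr_ge0 // exprn_ge0 // ltW.
exists (eps / 2 / A) => [|y q yab qab yq n]; first by rewrite !divr_gt0.
apply: (@le_trans _ _ (\sum_(j < N + n) orbit_dist y q j.+1)).
  rewrite addnC big_split_ord /= lerDl.
  by apply: sumr_ge0 => j _; apply: normr_ge0.
rewrite big_split_ord /= [leRHS](_ : _ = eps / 2 + eps / 2); last by field.
apply: lerD.
  apply: (@le_trans _ _ (\sum_(j < N) K ^+ N * `|y - q|)).
    apply: ler_sum => j _; apply: le_trans (HK _ _ _ yab qab) _.
    by rewrite ler_wpM2r // ler_weXn2l.
  rewrite sumr_const card_ord -[leLHS]mulr_natl mulrA.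
  (* the summand 1 in A only makes A positive when N = 0 *)
  apply: (@le_trans _ _ (A * `|y - q|)).
    by rewrite ler_wpM2r // lerDl.
  by rewrite -ler_pdivlMl // mulrC.
apply: (@le_trans _ _ (\sum_(i < n) (2 * r ^+ N) * r ^+ i)).
  apply: ler_sum => i _; rewrite -mulrA -exprD.
  have c01 := c_bounds.
  have near_c z : a <= z <= b -> `|iter (N + i).+1 g z - c| <= r ^+ (N + i).
    move=> zab; apply: le_trans (Hr _ _ zab) _.
    have z01 := window01 zab; rewrite -[leRHS]mulr1.
    apply: ler_pM; rewrite ?exprn_ge0 ?(ltW r0) //.
      by rewrite exprS ler_piMl ?exprn_ge0 ?ltW.
    by rewrite ler_norml; apply/andP; split; lra.
  have := lerD (near_c y yab) (near_c q qab); rewrite mulr_natl mulr2n.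
  by apply: le_trans; rewrite [X in _ + X]distrC; apply: ler_distD.
rewrite -mulr_sumr; apply: (@le_trans _ _ (2 * r ^+ N * (1 - r)^-1)).
  by rewrite ler_wpM2l ?sum_geometric_le // mulr_ge0 // exprn_ge0 // ltW.
by rewrite ler_pdivrMr //; lra.
Qed.

(** The factors 1 + e of the successive steps multiply to 1 + d; while the sum
    of the |e| is at most 1/2, |d| is at most twice this sum. *)
Lemma iter_inv_branch_expansion (L y q : R) : 0 < L ->
  (forall u v, a <= u <= b -> a <= v <= b ->
    exists2 e : R, (u - v) * P^`().[v] = (P.[u] - P.[v]) * (1 + e)
      & `|e| <= L * `|u - v|) ->
  a <= y <= b -> a <= q <= b ->
  (forall n, L * \sum_(j < n) orbit_dist y q j.+1 <= 1 / 2) ->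
  forall n, exists2 d : R,
    iter n g y - iter n g q = inv_slope n q * (y - q) * (1 + d)
    & `|d| <= 2 * (L * \sum_(j < n) orbit_dist y q j.+1).
Proof.
move=> L0 step yab qab small; elim=> [|n [d E dn]].
  exists 0; last by rewrite big_ord0 normr0 !mulr0.
  by rewrite /inv_slope big_ord0 addr0 mulr1 mul1r.
have vab := iter_inv_branch_window n.+1 qab.
have [e] := step _ _ (iter_inv_branch_window n.+1 yab) vab.
rewrite !inv_branchK ?window01 ?iter_inv_branch_window // E => Ee en.
exists (d + e * (1 + d)).
  rewrite inv_slopeS; apply: (@mulIf _ P^`().[iter n.+1 g q]).
    by rewrite gt_eqF // dP_gt0 // window01.
  rewrite Ee; field.
  by rewrite gt_eqF // dP_gt0 // window01.
have d1 : `|1 + d| <= 2.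
  apply: le_trans (ler_normD _ _) _; rewrite normr1.
  by have := small n; lra.
apply: le_trans (ler_normD _ _) _; rewrite big_ord_recr /=.
rewrite [L * (_ + _)]mulrDr [2 * (_ + _)]mulrDr.
apply: lerD => //; rewrite normrM mulrC; apply: ler_pM => //.
Qed.

(** Bounded distortion: [eta] does not depend on [n]. *)
Lemma iter_inv_branch_linear_window (eps : R) : 0 < eps ->
  exists2 eta : R, 0 < eta &
  forall y q, a <= y <= b -> a <= q <= b -> `|y - q| <= eta -> forall n,
  `|iter n g y - iter n g q - inv_slope n q * (y - q)|
    <= eps * `|inv_slope n q * (y - q)|.
Proof.
move=> eps0; have [L L0 step] := inv_step_linear.
pose e1 := Num.min (1 / 2) (eps / 2).
have e10 : 0 < e1 by rewrite lt_min !divr_gt0.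
have [|eta eta0 small] := @sum_orbit_dist_small (e1 / L).
  by rewrite divr_gt0.
exists eta => // y q yab qab yq n.
have sm k : L * \sum_(j < k) orbit_dist y q j.+1 <= e1.
  by rewrite -ler_pdivlMl // mulrC small.
have [|d -> dn] := iter_inv_branch_expansion L0 step yab qab _ n.
  by move=> k; apply: le_trans (sm k) _; rewrite ge_min lexx.
rewrite mulrDr mulr1 addrAC subrr add0r normrM mulrC ler_wpM2r //.
apply: (le_trans dn); have := sm n; have : e1 <= eps / 2 by rewrite ge_min lexx orbT.
by lra.
Qed.

(** Each factor of [inv_slope] lies between two positive constants. *)
Lemma ln_inv_slope_window : exists2 C : R, 0 <= C &
  forall n q, a <= q <= b -> `|ln (inv_slope n q)| <= C * n%:R.
Proof.
have [m /andP [m0 m1] mP] := deriv_bounds.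
exists (- ln m) => [|n q qab]; first by rewrite oppr_ge0 ln_le0 // ltW.
elim: n => [|n IH]; first by rewrite /inv_slope big_ord0 ln1 normr0 mulr0.
have vab := iter_inv_branch_window n.+1 qab.
have Dv := dP_gt0 (window01 vab).
rewrite inv_slopeS lnM ?posrE ?invr_gt0 ?inv_slope_gt0 ?window01 //.
apply: le_trans (ler_normD _ _) _.
rewrite -natr1 mulrDr mulr1 lerD // lnV ?posrE // normrN ler_norml opprK.
have /andP [lo hi] := mP _ vab.
by rewrite -lnV ?posrE // !ler_ln ?posrE ?invr_gt0 ?lo.
Qed.

End Window.

Lemma window_around (q : R) : 0 < q < 1 ->
  exists a b, [/\ 0 < a, a <= c, c <= b & b < 1] /\ a < q < b.
Proof.
move=> q01; have c01 := c_bounds.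
have [a [a0 ac aq]] : exists a, [/\ 0 < a, a <= c & a < q].
  by have [qc|cq] := leP q c; [exists (q / 2)|exists (c / 2)]; split; lra.
have [b [b1 cb qb]] : exists b, [/\ b < 1, c <= b & q < b].
  by have [qc|cq] := leP q c; [exists ((c + 1) / 2)|exists ((q + 1) / 2)]; split; lra.
by exists a, b; rewrite aq.
Qed.

Lemma iter_inv_branch_linear (q eps : R) : 0 < q < 1 -> 0 < eps ->
  exists2 eta : R, 0 < eta & forall y, `|y - q| <= eta -> 0 < y < 1 /\ forall n,
  `|iter n g y - iter n g q - inv_slope n q * (y - q)|
    <= eps * `|inv_slope n q * (y - q)|.
Proof.
move=> q01 eps0; have [a [b [[a0 ac cb b1] /andP [aq qb]]]] := window_around q01.
have [eta eta0 lin] := iter_inv_branch_linear_window a0 ac cb b1 eps0.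
exists (Num.min eta (Num.min (q - a) (b - q))) => [|y].
  by rewrite !lt_min eta0 !subr_gt0 aq.
rewrite !le_min => /and3P [yq yq1 yq2].
have yab : a <= y <= b.
  by move: yq1 yq2; rewrite !ler_norml => /andP [? ?] /andP [? ?]; apply/andP; split; lra.
split; first exact: window01 yab.
by apply: lin => //; rewrite !ltW.
Qed.

(** Inversion of [iter_inv_branch_linear].  With a relative error e / 2, the
    backward images of q + (1 - e) s and q + (1 + e) s lie on either side of
    [x], because (1 - e)(1 + e / 2) <= 1 <= (1 + e)(1 - e / 2) for e <= 1; the
    forward iterate, being increasing, keeps this order. *)
Lemma iter_horner_linear (q eps : R) : 0 < q < 1 -> 0 < eps ->
  exists2 eta : R, 0 < eta & forall s, `|s| <= eta -> forall n,
  let x := iter n g q + inv_slope n q * s in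
  0 < x < 1 /\ `|iter n (horner P) x - (q + s)| <= eps * `|s|.
Proof.
move=> q01 eps0; pose e := Num.min eps 1.
have e0 : 0 < e by rewrite lt_min eps0 ltr01.
have e1 : e <= 1 by rewrite ge_min lexx orbT.
have ee : e <= eps by rewrite ge_min lexx.
have [|eta eta0 lin] := @iter_inv_branch_linear q (e / 2) q01; first by rewrite divr_gt0.
exists (eta / 2) => [|s seta n x]; first by rewrite divr_gt0.
have D0 := inv_slope_gt0 n q01.
(* both y - q = (1 - e) s and y - q = (1 + e) s are at most 2 |s| <= eta *)
have near_q t : `|t| <= 2 -> `|q + t * s - q| <= eta.
  move=> t2; rewrite addrAC subrr add0r normrM [leRHS](_ : _ = 2 * (eta / 2)); last by field.
  exact: ler_pM.
have [|y101 lin1] := lin (q + (1 - e) * s) (near_q _ _).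
- by rewrite ler_norml; apply/andP; split; lra.
have [|y201 lin2] := lin (q + (1 + e) * s) (near_q _ _).
- by rewrite ler_norml; apply/andP; split; lra.
suff [x01 bnd] : 0 < x < 1 /\ `|iter n (horner P) x - (q + s)| <= e * `|s|.
  by split=> //; apply: le_trans bnd _; rewrite ler_wpM2r.
have between y z : 0 < y < 1 -> 0 < z < 1 -> iter n g y <= x <= iter n g z ->
    0 < x < 1 /\ y <= iter n (horner P) x <= z.
  move=> y01 z01 /andP [yx xz].
  have gy := iter_inv_branch01 n y01; have gz := iter_inv_branch01 n z01.
  have x01 : 0 < x < 1 by apply/andP; split; lra.
  split=> //; rewrite -{1}(iter_inv_branchK n y01) -(iter_inv_branchK n z01).
  by rewrite !iter_horner_le.
have shift t : q + t * s - q = t * s by ring.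
have scale t : 0 <= t ->
    `|inv_slope n q * (t * s)| = t * (inv_slope n q * `|s|).
  by move=> t0; rewrite !normrM (ger0_norm t0) (ger0_norm (ltW D0)) mulrCA.
move: (lin1 n) (lin2 n); rewrite !shift !scale ?subr_ge0 ?addr_ge0 ?ler01 ?(ltW e0) //.
rewrite !ler_norml => /andP [l1 u1] /andP [l2 u2].
have [s0|s0] := leP 0 s.
  have Es : `|s| = s by rewrite ger0_norm.
  rewrite Es in l1 u1 l2 u2.
  have Z0 : 0 <= inv_slope n q * s by rewrite mulr_ge0 // ltW.
  have Z1 : 0 <= e * (inv_slope n q * s) by rewrite mulr_ge0 // ltW.
  have Z2 : 0 <= (1 - e) * (e * (inv_slope n q * s)) by rewrite mulr_ge0 // subr_ge0.
  have [|x01 /andP [lo hi]] := between _ _ y101 y201.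
    by rewrite /x; apply/andP; split; lra.
  by split=> //; rewrite Es; apply/andP; split; lra.
have Es : `|s| = - s by rewrite ltr0_norm.
rewrite Es in l1 u1 l2 u2.
have Z0 : 0 <= inv_slope n q * (- s) by rewrite mulr_ge0 ?oppr_ge0 // ltW.
have Z1 : 0 <= e * (inv_slope n q * (- s)) by rewrite mulr_ge0 // ltW.
have Z2 : 0 <= (1 - e) * (e * (inv_slope n q * (- s))) by rewrite mulr_ge0 // subr_ge0.
have [|x01 /andP [lo hi]] := between _ _ y201 y101.
  by rewrite /x; apply/andP; split; lra.
by split=> //; rewrite Es; apply/andP; split; lra.
Qed.

Lemma ln_inv_slope_le (q : R) : 0 < q < 1 ->
  exists2 C : R, 0 <= C & forall n, `|ln (inv_slope n q)| <= C * n%:R.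
Proof.
move=> q01; have [a [b [[a0 ac cb b1] /andP [aq qb]]]] := window_around q01.
have [C C0 H] := ln_inv_slope_window a0 ac cb b1.
by exists C => // n; apply: H; rewrite !ltW.
Qed.

Lemma cvg_iter_inv_branch (q : R) : 0 < q < 1 ->
  (iter n g q @[n --> \oo] --> c)%classic.
Proof.
move=> q01; have [a [b [[a0 ac cb b1] /andP [aq qb]]]] := window_around q01.
have [r /andP [r0 r1] Hr] := iter_inv_branch_contracts a0 ac cb b1.
have qab : a <= q <= b by rewrite !ltW.
apply/cvgrPdist_le => eps eps0.
have r1' : `|r| < 1 by rewrite ger0_norm // ltW.
have /cvgrPdist_le /(_ _ eps0) := cvg_expr r1'; apply: filterS => n.
have rn : 0 <= r ^+ n by rewrite exprn_ge0 // ltW.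
rewrite /= sub0r normrN (ger0_norm rn); apply: le_trans.
rewrite distrC; apply: le_trans (Hr n q qab) _.
rewrite ler_piMr // ler_norml; have := c_bounds.
by move: q01 => /andP [? ?] /andP [? ?]; apply/andP; split; lra.
Qed.

End InverseBranch.

(** * Rescaled limits *)

Lemma derive1_horner (R : realType) (P : {poly R}) (x : R) :
  derive1 (horner P) x = P^`().[x].
Proof. by rewrite derive1E derive_val. Qed.

Lemma derive1_first_order (R : realType) (h : R -> R) (q eps : R) :
  derivable h q 1 -> h q = 0 -> derive1 h q = 1 -> 0 < eps ->
  exists2 eta : R, 0 < eta &
    forall y, `|y - q| <= eta -> `|h y - (y - q)| <= eps * `|y - q|.
Proof.
move=> dh hq h1 eps0.
have : (t^-1 *: (h (t + q) - h q) @[t --> 0^'] --> (1 : R))%classic.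
  rewrite -h1 derive1E.
  have : cvg ((t^-1 *: (h (t *: 1 + q) - h q)) @[t --> (0 : R)^'])%classic := dh.
  rewrite /derive; under eq_fun do rewrite [_ *: 1]mulr1.
  exact: id.
move=> /cvgrPdist_le /(_ _ eps0) [e /= e0 He].
exists (e / 2) => [|y yq]; first exact: divr_gt0.
have [->|nyq] := eqVneq y q; first by rewrite subrr subr0 hq normr0 mulr0.
have := He (y - q); rewrite /= sub0r normrN subrK hq subr0 => H.
have nz : y - q != 0 by rewrite subr_eq0.
have {H} : `|1 - (y - q)^-1 * h y| <= eps.
  by apply: H => //; apply: le_lt_trans yq _; lra.
rewrite -(ler_pM2r (_ : 0 < `|y - q|)) ?normr_gt0 // -normrM mulrBl mul1r.
by rewrite -mulrA [h y * _]mulrC mulKf // distrC.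
Qed.

Lemma iter_conjugate (R : realType) (f h : R -> R) (z : R) :
  (forall x, 0 < x < 1 -> 0 < f x < 1) ->
  (forall x, 0 < x < 1 -> h (f x) = z * h x) ->
  forall n x, 0 < x < 1 -> 0 < iter n f x < 1 /\ h (iter n f x) = z ^+ n * h x.
Proof.
move=> f01 hf n x x01; elim: n => [|n [IH01 IH]]; first by rewrite mul1r.
by split; [exact: f01|rewrite [iter _ _ _]/= hf // IH mulrA exprS].
Qed.

Lemma cvg_divX (R : realType) (z a : R) (g : nat -> nat) : 1 < z ->
  (g k @[k --> \oo] --> \oo)%classic ->
  (a / z ^+ g k @[k --> \oo] --> (0 : R))%classic.
Proof.
move=> z1 goo; rewrite -(mulr0 a); apply: cvgMr.
have /cvg_expr zx : `|z^-1| < 1.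
  by rewrite normfV invf_lt1 ?normr_gt0 ?gt_eqF ?ger0_norm; lra.
have -> : (fun k => (z ^+ g k)^-1) = (fun n => z^-1 ^+ n) \o g.
  by apply/funext => k; rewrite /= exprVn.
exact: (cvg_comp _ _ goo zx).
Qed.

Local Open Scope classical_set_scope.
Local Open Scope ring_scope.

Theorem theorem10p1 (R : realType) (Gl Gg : pgraph)
    (pl pg zeta_l zeta_g : R) (hg hg_inv : R -> R) (l g : nat -> nat)
    (Hl : admissible Gl) (Hg : admissible Gg)
    (Hpl : unique_fixed_point (@crossing R Gl) pl)
    (Hpg : unique_fixed_point (@crossing R Gg) pg)
    (Hzl : zeta_l = derive1 (@crossing R Gl) pl) (Hzl1 : 1 < zeta_l)
    (Hzg : zeta_g = derive1 (@crossing R Gg) pg) (Hzg1 : 1 < zeta_g)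
    (Hdiff : diffeo01 hg hg_inv)
    (Hconj : forall x : R, 0 < x < 1 -> hg (crossing Gg x) = zeta_g * hg x)
    (Hnorm : derive1 hg pg = 1)
    (l_pos : forall k : nat, (0 < l k)%N) (g_pos : forall k : nat, (0 < g k)%N)
    (l_oo : l k @[k --> \oo] --> \oo) (g_oo : g k @[k --> \oo] --> \oo) :
  exists p_ zeta_ : nat -> R,
    [/\ (forall k : nat, 0 < p_ k < 1),
        (forall k : nat, 0 < zeta_ k),
        (forall lambda : R,
           (\forall k \near \oo, 0 <= p_ k + lambda / zeta_ k <= 1) /\
           crossing (hybrid Gl Gg (l k) (g k)) (p_ k + lambda / zeta_ k)
             @[k --> \oo] --> hg_inv lambda),
        (p_ k @[k --> \oo] --> pl)
      & ((l k)%:R / (g k)%:R : R) @[k --> \oo] --> (0 : R) ->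
        (ln (zeta_ k) / (l k + g k)%:R) @[k --> \oo] --> ln zeta_g].
Proof.
have nl := admissible_neq Hl; have ng := admissible_neq Hg.
have [l0 l1 dl] := @crossing_poly_admissible R _ Hl.
have [g0 g1 dg] := @crossing_poly_admissible R _ Hg.
have [pg01 fpg _] := Hpg; have [h_inv_l h_inv_r dh dhinv] := Hdiff.
have fg01 x : 0 < x < 1 -> 0 < @crossing R Gg x < 1.
  by rewrite crossing_horner; exact: horner01.
move: Hpl Hzl; rewrite crossing_horner derive1_horner => fixl Hzl.
have dl1 : 1 < (crossing_poly R Gl)^`().[pl] by rewrite -Hzl.
set P := crossing_poly R Gl in l0 l1 dl fixl dl1.
have z0 : 0 < zeta_g by lra.
(* the conjugacy at the fixed point pg reads hg pg = zeta_g * hg pg *)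
have hg_pg : hg pg = 0.
  have := Hconj pg pg01; rewrite fpg => /eqP; rewrite -subr_eq0 -{1}(mul1r (hg pg)).
  by rewrite -mulrBl mulf_eq0 subr_eq0 lt_eqF //= => /eqP.
have D0 n : 0 < inv_slope P n pg by exact: inv_slope_gt0.
exists (fun k => iter (l k) (inv_branch P) pg).
exists (fun k => zeta_g ^+ g k / inv_slope P (l k) pg).
split=> [k|k|lambda||].
- exact: iter_inv_branch01.
- by rewrite divr_gt0 // exprn_gt0.
- pose s k := lambda / zeta_g ^+ g k.
  have Z0 k : 0 < zeta_g ^+ g k by rewrite exprn_gt0.
  pose x k := iter (l k) (inv_branch P) pg + inv_slope P (l k) pg * s k.
  have xE : x = fun k => iter (l k) (inv_branch P) pg
      + lambda / (zeta_g ^+ g k / inv_slope P (l k) pg).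
    by apply/funext => k; rewrite /x /s invf_div mulrCA mulrA mulrC mulrA.
  suff : (\forall k \near \oo, 0 <= x k <= 1) /\
      crossing (hybrid Gl Gg (l k) (g k)) (x k) @[k --> \oo] --> hg_inv lambda.
    by rewrite xE.
  pose y k := iter (l k) (horner P) (x k).
  have s_small := cvg_divX lambda Hzg1 g_oo.
  have key eps : 0 < eps -> \forall k \near \oo,
      0 < x k < 1 /\ `|y k - (pg + s k)| <= eps * `|s k|.
    move=> eps0; have [eta eta0 lin] := iter_horner_linear l0 l1 dl fixl dl1 pg01 eps0.
    have /cvgrPdist_le /(_ _ eta0) := s_small; apply: filterS => k.
    by rewrite sub0r normrN => /lin /(_ (l k)).
  have x01 : \forall k \near \oo, 0 < x k < 1.
    by have := key 1 ltr01; apply: filterS => k [].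
  split.
    by move: x01; apply: filterS => k /andP [? ?]; rewrite !ltW.
  have hy : zeta_g ^+ g k * hg (y k) @[k --> \oo] --> lambda.
    apply/cvgrPdist_le => eps eps0.
    (* two errors e, one for hg and one for the iterate of f_l, give a total
       error of at most 3 e |s k|, which zeta_g ^+ g k turns into 3 e |lambda| *)
    pose e := Num.min 1 (eps / (3 * (`|lambda| + 1))).
    have lam0 : 0 <= `|lambda| by [].
    have e0 : 0 < e by rewrite lt_min ltr01 divr_gt0 //; lra.
    have [eta eta0 hlin] := derive1_first_order (dh pg pg01).1 hg_pg Hnorm e0.
    have /cvgrPdist_le /(_ (eta / 2)) s_eta := s_small.
    have {}s_eta := s_eta (divr_gt0 eta0 (ltr0Sn _ 1)).
    move: (key e e0) s_eta; apply: filterS2 => k [_ yk].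
    rewrite sub0r normrN -/(s k) => sk.
    have e1 : e <= 1 by rewrite ge_min lexx.
    have e2 : e * `|s k| <= `|s k| by rewrite ler_piMl.
    have yk2 : `|y k - pg| <= 2 * `|s k|.
      have -> : y k - pg = (y k - (pg + s k)) + s k by ring.
      by apply: le_trans (ler_normD _ _) _; lra.
    have hk : `|hg (y k) - (y k - pg)| <= e * `|y k - pg|.
      by apply: hlin; lra.
    have hs : `|hg (y k) - s k| <= 3 * e * `|s k|.
      have -> : hg (y k) - s k = (hg (y k) - (y k - pg)) + (y k - (pg + s k)) by ring.
      apply: le_trans (ler_normD _ _) _.
      have : e * `|y k - pg| <= e * (2 * `|s k|) by rewrite ler_wpM2l // ltW.
      by lra.
    have -> : lambda - zeta_g ^+ g k * hg (y k) = zeta_g ^+ g k * - (hg (y k) - s k).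
      by rewrite /s; field; rewrite gt_eqF.
    rewrite normrM normrN ger0_norm ?(ltW (Z0 k)) //.
    apply: (@le_trans _ _ (zeta_g ^+ g k * (3 * e * `|s k|))).
      by rewrite ler_wpM2l // ltW.
    have -> : zeta_g ^+ g k * (3 * e * `|s k|) = e * (3 * `|lambda|).
      rewrite /s normrM normfV (ger0_norm (ltW (Z0 k))); field.
      by rewrite gt_eqF.
    apply: (@le_trans _ _ (e * (3 * (`|lambda| + 1)))).
      by rewrite ler_wpM2l ?(ltW e0) // ler_pM2l // lerDl.
    by rewrite -ler_pdivlMr; [rewrite ge_min lexx orbT|lra].
  have cont : {for lambda, continuous hg_inv}.
    by apply/differentiable_continuous/derivable1_diffP; exact: (dhinv lambda).1.
  have := cvg_comp _ _ hy cont; apply: cvg_trans; apply: near_eq_cvg.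
  move: x01; apply: filterS => k xk.
  rewrite crossing_hybrid // [in iter (l k) _ _]crossing_horner -/P -/(y k) /=.
  have yk : 0 < y k < 1 by exact: iter_horner01.
  have [it01 <-] := iter_conjugate fg01 Hconj (g k) yk.
  by rewrite h_inv_l.
- exact: (cvg_comp _ _ l_oo (cvg_iter_inv_branch l0 l1 dl fixl dl1 pg01)).
move=> lg; have [C C0 HC] := ln_inv_slope_le l0 l1 dl fixl dl1 pg01.
have lz : 0 <= ln zeta_g by rewrite ln_ge0 // ltW.
apply/cvgrPdist_le => eps eps0.
have C1 : 0 < ln zeta_g + C + 1 by lra.
have /cvgrPdist_le /(_ _ (divr_gt0 eps0 C1)) := lg; apply: filterS => k.
have gk : (0 : R) < (g k)%:R by rewrite ltr0n.
have lk : (0 : R) < (l k)%:R by rewrite ltr0n.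
rewrite sub0r normrN ger0_norm ?divr_ge0 // ler_pdivlMr // => small.
rewrite lnM ?posrE ?exprn_gt0 ?invr_gt0 // lnXn // lnV ?posrE // natrD.
(* the terms in g k cancel, leaving a numerator of order l k *)
have -> : ln zeta_g - (ln zeta_g *+ g k - ln (inv_slope P (l k) pg))
      / ((l k)%:R + (g k)%:R) =
    ((l k)%:R * ln zeta_g + ln (inv_slope P (l k) pg)) / ((l k)%:R + (g k)%:R).
  by rewrite -mulr_natr; field; rewrite gt_eqF // addr_gt0.
rewrite normrM normfV [`|_ + (g k)%:R|]gtr0_norm ?addr_gt0 //.
rewrite ler_pdivrMr ?addr_gt0 //.
apply: le_trans (ler_normD _ _) _; rewrite ger0_norm ?mulr_ge0 //.
have := HC (l k).
have : (l k)%:R * (ln zeta_g + C + 1) <= eps * (g k)%:R.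
  by move: small; rewrite mulrAC ler_pdivrMr.
have : 0 <= eps * (l k)%:R by rewrite mulr_ge0 // ltW.
by move: lk; lra.
Qed.
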